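(* Let $X$ be a continuum. If $p\in X$ is such that $HS(p,X)$ is locally connected at the point $C^X_p$, then $HS(p,X)$ is aposyndetic at $C^X_p$, and for each two points $a,b\in HS(p,X)-\{C^X_p\}$ with $a\neq b$, $HS(p,X)$ is aposyndetic at $a$ with respect to $b$.
   Context: A continuum is a nondegenerate (more than one point) compact connected metric space. For a continuum $X$, $C(X)$ is the hyperspace of all subcontinua of $X$, i.e. all nonempty closed connected subsets of $X$ (singletons included), with the Hausdorff metric. For $p\in X$, $C(p,X)=\{A\in C(X):p\in A\}$, and $HS(p,X)=C(X)/C(p,X)$ is the quotient space obtained from $C(X)$ by shrinking $C(p,X)$ to a single point; this point is denoted $C^X_p$. $HS(p,X)$ is a continuum. A space is locally connected at a point if every open neighborhood of the point contains a connected open neighborhood of it. For a continuum $Y$ and $x\neq y$ in $Y$, $Y$ is aposyndetic at $x$ with respect to $y$ provided there exists a subcontinuum $M$ of $Y$ such that $x\in\mathrm{int}(M)$ and $y\in Y-M$. $Y$ is aposyndetic at $x$ if it is aposyndetic at $x$ with respect to $y$ for each $y\in Y-\{x\}$. *)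

(* Defs.v *)
From HB Require Import structures.
From mathcomp Require Import all_boot all_order all_algebra generic_quotient.
From mathcomp Require Import all_classical all_reals all_analysis.

Set Implicit Arguments.
Unset Strict Implicit.
Unset Printing Implicit Defensive.

Import Order.TTheory GRing.Theory Num.Theory.

Local Open Scope classical_set_scope.
Local Open Scope ring_scope.
Local Open Scope quotient_scope.

HB.mixin Record Metric_isContinuum (R : realType) X & Metric R X := {
  continuum_compact : compact [set: X];
  continuum_connected : connected [set: X];
  continuum_nondegenerate : exists x y : X, x <> y
}.

#[short(type="continuumType")]
HB.structure Definition Continuum (R : realType) :=
  { X of Metric R X & Metric_isContinuum R X }.

(* Used both for X and for its quotient HS p; these spaces are compact
   Hausdorff, so "closed" amounts to "compact". Singletons are allowed. *)
Definition is_subcontinuum (Y : topologicalType) (A : set Y) : Prop :=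
  [/\ A !=set0, closed A & connected A].

Section hausdorff_dist.
Context {R : realType} {X : metricType R}.
Implicit Types (A B C : set X) (r : R).

Definition thicken A r : set X := \bigcup_(a in A) ball a r.

Definition hausdorff_radii A B : set R :=
  [set r | [/\ 0 < r, A `<=` thicken B r & B `<=` thicken A r]].

(* The infimum is over a nonempty set when X is compact and A, B are nonempty
   (hausdorff_radii_neq0); otherwise inf returns a default value. *)
Definition hausdorff_dist A B : R := inf (hausdorff_radii A B).

Lemma thickenP A r x :
  thicken A r x <-> exists2 a, A a & mdist a x < r.
Proof. by split=> -[a Aa]; rewrite ?ballEmdist => ?; exists a; rewrite ?ballEmdist. Qed.

Lemma hausdorff_radii_lbound A B : lbound (hausdorff_radii A B) 0.
Proof. by move=> r [/ltW]. Qed.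

Lemma hausdorff_dist_le A B r : hausdorff_radii A B r -> hausdorff_dist A B <= r.
Proof.
by move=> Ar; apply: ge_inf => //; exists 0; exact: hausdorff_radii_lbound.
Qed.

Lemma hausdorff_dist_lt A B r : hausdorff_radii A B !=set0 ->
  hausdorff_dist A B < r -> exists2 s, hausdorff_radii A B s & s < r.
Proof.
move=> AB0 ABr; have [||s ABs sr] := @inf_adherent _ (hausdorff_radii A B)
  (r - hausdorff_dist A B); first by rewrite subr_gt0.
- by split => //; exists 0; exact: hausdorff_radii_lbound.
- by exists s => //; move: sr; rewrite addrC subrK.
Qed.

Lemma hausdorff_radii_neq0 A B : compact [set: X] ->
  A !=set0 -> B !=set0 -> hausdorff_radii A B !=set0.
Proof.
move=> /compact_near_coveringP cX [a Aa] [b Bb].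
have [|m [_ ma]] := cX R (+oo : set_system R) (fun r x => mdist a x < r) _.
  move=> x _; exists (ball x 1, [set r | mdist a x + 1 < r]).
    split; first exact: nbhsx_ballx.
    by exists (mdist a x + 1); split => //; exact: num_real.
  case=> y r /= [xy]; apply: le_lt_trans.
  rewrite (le_trans (metric_triangle a x y))// lerD2l ltW//.
  by move: xy; rewrite ballEmdist.
have {ma} {}ma x : mdist a x < m + 1 by apply: (ma (m + 1)); rewrite ?ltrDl.
have m0 : 0 < m + 1 by rewrite -(mdistxx a) ma.
exists (m + 1 + (m + 1)); split.
- exact: addr_gt0.
- move=> x _; apply/thickenP; exists b => //.
  by rewrite (le_lt_trans (metric_triangle b a x))// ltrD// metric_sym.
- move=> x _; apply/thickenP; exists a => //.
  by rewrite (lt_le_trans (ma x))// lerDl ltW.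
Qed.

Lemma hausdorff_radiiC A B : hausdorff_radii A B = hausdorff_radii B A.
Proof. by apply/seteqP; split => r []. Qed.

End hausdorff_dist.

Record subcontinuum (R : realType) (X : continuumType R) := Subcontinuum {
  subcontinuum_set :> set X;
  subcontinuumP : is_subcontinuum subcontinuum_set
}.

Section hyperspace.
Context {R : realType} (X : continuumType R).
Implicit Types A B C : subcontinuum X.

HB.instance Definition _ := gen_eqMixin (subcontinuum X).
HB.instance Definition _ := gen_choiceMixin (subcontinuum X).

Lemma subcontinuum_inj A B : A = B :> set X -> A = B.
Proof. by case: A B => [A Ap] [B Bp] /= AB; subst B; congr Subcontinuum. Qed.

Let mdistC A B : R := hausdorff_dist A B.

Let radii_neq0 A B : hausdorff_radii A B !=set0.
Proof.
case: (subcontinuumP A) (subcontinuumP B) => A0 _ _ [B0 _ _].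
exact: (hausdorff_radii_neq0 continuum_compact).
Qed.

Let mdistCxx A : mdistC A A = 0.
Proof.
apply/eqP; rewrite eq_le; apply/andP; split.
  apply/ler_addgt0Pl => e e0; rewrite addr0; apply: hausdorff_dist_le.
  by split => // x Ax; apply/thickenP; exists x; rewrite ?mdistxx.
exact: lb_le_inf (radii_neq0 _ _) (@hausdorff_radii_lbound _ _ _ _).
Qed.

Let mdistC_sym A B : mdistC A B = mdistC B A.
Proof. by rewrite /mdistC /hausdorff_dist hausdorff_radiiC. Qed.

Let mdistC_subset A B : mdistC A B = 0 -> (A : set X) `<=` B.
Proof.
move=> AB x Ax; have [_ + _] := subcontinuumP B; apply => U /nbhs_ballP[e /= e0 eU].
have [|r [_ AB' _] re] := @hausdorff_dist_lt _ _ A B e (radii_neq0 A B).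
  by rewrite -[ltLHS]/(mdistC A B) AB.
have /thickenP[b Bb bx] := AB' _ Ax.
exists b; split => //; apply: eU; rewrite ballEmdist /= metric_sym.
exact: lt_trans re.
Qed.

Let mdistC_positivity A B : mdistC A B = 0 -> A = B.
Proof.
move=> AB; apply/subcontinuum_inj/seteqP; split; first exact: mdistC_subset.
by apply: mdistC_subset; rewrite mdistC_sym.
Qed.

Let mdistC_triangle B A C : mdistC A C <= mdistC A B + mdistC B C.
Proof.
apply/ler_addgt0Pl => e e0.
have e20 : 0 < e / 2 by rewrite divr_gt0.
have [|r [r0 AB BA] re] := @hausdorff_dist_lt _ _ A B (mdistC A B + e / 2)
  (radii_neq0 A B); first by rewrite ltrDl.
have [|s [s0 BC CB] se] := @hausdorff_dist_lt _ _ B C (mdistC B C + e / 2)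
  (radii_neq0 B C); first by rewrite ltrDl.
apply: (@le_trans _ _ (r + s)); last first.
  by rewrite [leRHS]addrC {1}(splitr e) addrACA ltW// ltrD.
apply: hausdorff_dist_le; split; first exact: addr_gt0.
- move=> x /AB /thickenP[y /BC /thickenP[z Cz zy] yx].
  apply/thickenP; exists z => //.
  by rewrite (le_lt_trans (metric_triangle z y x))// addrC ltrD.
- move=> x /CB /thickenP[y /BA /thickenP[z Az zy] yx].
  apply/thickenP; exists z => //.
  by rewrite (le_lt_trans (metric_triangle z y x))// ltrD.
Qed.

HB.instance Definition _ := @isMetric.Build R (subcontinuum X) mdistC
  mdistCxx mdistC_positivity mdistC_sym mdistC_triangle.

Lemma mdist_subcontinuumE A B : mdist A B = hausdorff_dist A B.
Proof. by []. Qed.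

Lemma is_subcontinuum1 (p : X) : is_subcontinuum [set p].
Proof.
split; [by exists p| |exact: connected1].
by apply: accessible_closed_set1; apply/hausdorff_accessible/metric_hausdorff.
Qed.

Definition subcontinuum1 (p : X) : subcontinuum X :=
  Subcontinuum (is_subcontinuum1 p).

End hyperspace.

(* T / S: the quotient of T that shrinks S to a point *)
Section shrink.
Context {T : topologicalType} (S : set T).

Let shrink_rel' (a b : T) : bool := `[< a = b \/ S a /\ S b >].

Let shrink_rel_refl : reflexive shrink_rel'.
Proof. by move=> a; apply/asboolP; left. Qed.

Let shrink_rel_sym : symmetric shrink_rel'.
Proof.
move=> a b; apply/asboolP/asboolP; by move=> [->|[? ?]]; [left|right].
Qed.

Let shrink_rel_trans : transitive shrink_rel'.
Proof.
move=> b a c /asboolP ab /asboolP bc; apply/asboolP.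
case: ab => [->//|[Sa Sb]]; case: bc => [<-|[_ Sc]]; by right.
Qed.

Definition shrink_rel :=
  EquivRel shrink_rel' shrink_rel_refl shrink_rel_sym shrink_rel_trans.

Definition shrink := quotient_topology {eq_quot shrink_rel}.

HB.instance Definition _ := Topological.on shrink.
HB.instance Definition _ := Quotient.on shrink.

Lemma shrink_piP (a b : T) :
  \pi_shrink a = \pi_shrink b <-> a = b \/ S a /\ S b.
Proof. by split=> [/eqmodP/asboolP|h]; last exact/eqmodP/asboolP. Qed.

Lemma shrink_openP (U : set shrink) : open U <-> open (\pi_shrink @^-1` U).
Proof. by []. Qed.

End shrink.

Section HS.
Context {R : realType} {X : continuumType R}.

Definition C_at (p : X) : set (subcontinuum X) :=
  [set A | (A : set X) p].

Definition HS (p : X) : topologicalType := shrink (C_at p).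

(* C^X_p is the class of every member of C(p, X), see HS_pointP; {p} is only
   a representative. *)
Definition HS_point (p : X) : HS p :=
  \pi_(shrink (C_at p)) (subcontinuum1 p).

Lemma HS_pointP (p : X) (A : subcontinuum X) :
  \pi_(shrink (C_at p)) A = HS_point p <-> C_at p A.
Proof. by rewrite shrink_piP; split=> [[->//|[]//]|]; right. Qed.

End HS.

Definition locally_connected_at (Y : topologicalType) (x : Y) : Prop :=
  forall U : set Y, open U -> U x ->
  exists V : set Y, [/\ open V, V x, connected V & V `<=` U].

(* x <> y is not assumed: it follows from x in M and y not in M. *)
Definition aposyndetic_wrt (Y : topologicalType) (x y : Y) : Prop :=
  exists M : set Y, [/\ is_subcontinuum M, M° x & ~ M y].

Definition aposyndetic_at (Y : topologicalType) (x : Y) : Prop :=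
  forall y : Y, y <> x -> aposyndetic_wrt x y.

(* Main.v *)
Require Import Defs.
From mathcomp Require Import all_boot all_order all_algebra.
From mathcomp Require Import all_classical all_reals all_analysis.
From mathcomp Require Import generic_quotient.

(* At the point C_p itself, take the closure of a small connected open
   neighbourhood. For the classes of
   continua A <> B missing p, a connected set of subcontinua of X containing a
   ball around A and staying away from B is enough: its closure in the quotient
   is the required continuum. If A is not inside B, take all the continua
   containing some A' close to A. Otherwise B is nondegenerate and not inside A,
   and one can take all the singletons and all the subcontinua of the A' close
   to A. The first set is connected because order arcs lead to X, the second
   because order arcs lead down to the connected set of singletons. Instead of
   order arcs, Zorn's lemma and boundary bumping show directly that a set of
   subcontinua of Q closed upwards within Q is connected. *)

Set Implicit Arguments.
Unset Strict Implicit.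
Unset Printing Implicit Defensive.

Import Order.TTheory GRing.Theory Num.Theory.

Local Open Scope classical_set_scope.
Local Open Scope ring_scope.
Local Open Scope quotient_scope.

(** * Quasi-components and boundary bumping in compact Hausdorff spaces *)

Section compact_hausdorff.
Context {T : topologicalType}.
Implicit Types A B D E K Q W O : set T.

(** Otherwise the sets [F i] minus [O] generate a proper filter, and by compactness it has a cluster
    point, which lies in every [F i] but not in [O]. *)
Lemma directed_closed_sub_open (I : Type) (P : set I) (F : I -> set T) O :
  compact [set: T] -> P !=set0 ->
  (forall i j, P i -> P j -> exists2 k, P k & F k `<=` F i `&` F j) ->
  (forall i, P i -> closed (F i)) -> open O -> \bigcap_(i in P) F i `<=` O ->
  exists2 i, P i & F i `<=` O.
Proof.
move=> cT P0 Fdir Fcl oO FO; apply: contrapT => nFO.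
have filt : Filter (filter_from P (fun i => F i `\` O)).
  apply: filter_from_filter => // i j Pi Pj.
  by have [k Pk Fk] := Fdir i j Pi Pj; exists k => // x [/Fk[? ?] ?].
have proper : ProperFilter (filter_from P (fun i => F i `\` O)).
  apply: filter_from_proper => i Pi; apply: contrapT => /set0P/negP.
  rewrite negbK => /eqP FiO; apply: nFO; exists i => //.
  by rewrite -setD_eq0.
have [x [_ xcl]] := cT _ proper filterT.
have xF i : P i -> (F i `\` O) x.
  move=> Pi; have cFO : closed (F i `\` O).
    by apply: closedI; [exact: Fcl|exact: open_closedC].
  by apply: cFO => B; apply: xcl; exists i.
by case: (P0) => i /xF[_]; apply; apply: FO => j /xF[].
Qed.

Lemma compact_separate_closed A B : hausdorff_space T -> compact [set: T] ->
  closed A -> closed B -> A `&` B = set0 ->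
  exists U V, [/\ open U, open V, A `<=` U, B `<=` V & U `&` V = set0].
Proof.
move=> hT cT cA cB AB0.
have [|W /set_nbhsP[U [oU AU UW]] WB] :=
  compact_normal hT cT cA (_ : set_nbhs A (~` B)).
  apply/set_nbhsP; exists (~` B); split => //; first exact: closed_openC.
  exact/disjoints_subset.
exists U, (~` closure W); split => //.
- exact/closed_openC/closed_closure.
- by move=> x Bx /WB.
- by apply/disjoints_subset; rewrite setCK => x /UW /subset_closure.
Qed.

(** The intersection of this family is the quasi-component of [D] in [K]. For closed [K], closedness
    of both parts in [T] is clopenness of [W] in [K]. *)
Definition relatively_clopen_over K D :=
  [set W | [/\ closed W, closed (K `\` W), D `<=` W & W `<=` K]].

Lemma relatively_clopen_refl K D : closed K -> D `<=` K ->
  relatively_clopen_over K D K.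
Proof. by split; rewrite ?setDv//; exact: closed0. Qed.

Lemma relatively_clopen_sub_open K D O : compact [set: T] -> closed K ->
  D `<=` K -> open O -> \bigcap_(W in relatively_clopen_over K D) W `<=` O ->
  exists2 W, relatively_clopen_over K D W & W `<=` O.
Proof.
move=> cT cK DK oO KO; apply: (directed_closed_sub_open cT _ _ _ oO KO).
- by exists K; exact: relatively_clopen_refl.
- move=> V W [cV cKV DV VK] [cW cKW DW WK]; exists (V `&` W) => //; split.
  + exact: closedI.
  + by rewrite setDIr; exact: closedU.
  + by move=> x Dx; split; [exact: DV|exact: DW].
  + by move=> x [/VK].
- by move=> W [].
Qed.

(** If the quasi-component split into two closed pieces, disjoint open [U] and [V] would separate
    them. Some relatively clopen [W] lies in their union, and its part in [U] is again relatively
    clopen over [D] yet misses the second piece. *)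
Lemma connected_bigcap_clopen K D : hausdorff_space T -> compact [set: T] ->
  closed K -> connected D -> D !=set0 -> D `<=` K ->
  connected (\bigcap_(W in relatively_clopen_over K D) W).
Proof.
move=> hT cT cK cD [d Dd] DK; set M := \bigcap_(W in _) W.
have DM : D `<=` M by move=> x Dx W [_ _ DW _]; exact: DW.
have KK := relatively_clopen_refl cK DK.
have MK : M `<=` K by exact: bigcap_inf.
have cM : closed M by apply: closed_bigI => W [].
apply/connectedP => E [E0 ME sE].
wlog DE : E E0 ME sE / D `<=` E false.
  move=> G; have := connected_subset sE (_ : D `<=` _) cD; rewrite -ME.
  case=> // DE; first exact: (G E).
  by apply: (G (E \o negb)) => //=; rewrite 1?setUC 1?separatedC//; case=> /=.
have cE b : closed (E b).
  case: sE => s1 s2 x clEx.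
  have : M x.
    by apply: cM; apply: closureS clEx; rewrite ME; case: b; [right|left].
  rewrite ME; case: b clEx => clEx [] // Ex; exfalso.
  - by move: s2; apply/eqP/set0P; exists x.
  - by move: s1; apply/eqP/set0P; exists x.
have [U [V [oU oV EU EV UV]]] :=
  compact_separate_closed hT cT (cE false) (cE true) (separated_disjoint sE).
have [||W [cW cKW DW WK] WUV] :=
  @relatively_clopen_sub_open K D (U `|` V) cT cK DK.
- exact: openU.
- by move=> x; rewrite -/M ME => -[/EU|/EV]; [left|right].
have WU : W `&` U = W `\` V.
  apply/seteqP; split => x [Wx]; last by move=> nVx; split => //; case: (WUV _ Wx).
  by move=> Ux; split => // Vx; move: UV; apply/eqP/set0P; exists x.
have KWU : relatively_clopen_over K D (W `&` U).
  split.
  - by rewrite WU; apply: closedI => //; exact: open_closedC.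
  - by rewrite setDIr; apply: closedU => //; apply: closedI => //; exact: open_closedC.
  - by move=> x Dx; split; [exact: DW|exact/EU/DE].
  - by move=> x [/WK].
have [x Ex] := E0 true.
have [_ Ux] : (W `&` U) x by apply: (_ : M x) => //; rewrite ME; right.
by move: UV; apply/eqP/set0P; exists x; split => //; exact: EV.
Qed.

(* E is the quasi-component of D in a small closed neighbourhood K of D in Q:
   were it D, some relatively clopen part of K would be clopen in Q. *)
Lemma boundary_bumping D Q O : hausdorff_space T -> compact [set: T] ->
  is_subcontinuum D -> is_subcontinuum Q -> D `<=` Q -> D <> Q ->
  open O -> D `<=` O ->
  exists E, [/\ is_subcontinuum E, D `<=` E, E `<=` Q, E `<=` O & E <> D].
Proof.
move=> hT cT [D0 clD cD] [_ clQ cQ] DQ nDQ oO DO.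
have [q Qq nDq] : exists2 q, Q q & ~ D q.
  apply: contrapT => nq; apply: nDQ; apply/seteqP; split => // q Qq.
  by apply: contrapT => nDq; apply: nq; exists q.
have clq : closed [set q].
  by apply: accessible_closed_set1; exact: hausdorff_accessible.
(* Adding [q] to the set separated from [D] keeps [K] from being all of [Q]; this refutes [W = Q] at
   the end. *)
have [||U [V [oU oV DU OV UV]]] :=
  @compact_separate_closed D (~` O `|` [set q]) hT cT clD.
- by apply: closedU => //; exact: open_closedC.
- by apply/seteqP; split => // x [Dx [/(_ (DO _ Dx))//|xq]]; apply: nDq; rewrite -xq.
pose K := Q `\` V.
have clK : closed K by apply: closedI => //; exact: open_closedC.
have DK : D `<=` K.
  move=> x Dx; split; first exact: DQ.
  by move=> Vx; move: UV; apply/eqP/set0P; exists x; split => //; exact: DU.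
have KK := relatively_clopen_refl clK DK.
pose E := \bigcap_(W in relatively_clopen_over K D) W.
have EK : E `<=` K by exact: bigcap_inf.
have DE : D `<=` E by move=> x Dx W [_ _ DW _]; exact: DW.
exists E; split => //.
- split; first by case: D0 => d /DE Ed; exists d.
  + by apply: closed_bigI => W [].
  + exact: connected_bigcap_clopen.
- by move=> x /EK[].
- by move=> x /EK[_ nVx]; apply: contrapT => nOx; apply: nVx; apply: OV; left.
move=> EeD.
have [|W [cW cKW DW WK] WU] :=
  relatively_clopen_sub_open cT clK DK oU (_ : _ `<=` _).
  by rewrite -/E EeD.
have cQW : closed (Q `\` W).
  (* The part of [Q] cut off by [V] lies outside [U], and [W] lies inside [U]. *)
  have -> : Q `\` W = (K `\` W) `|` (Q `\` U).
    apply/seteqP; split => x.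
      move=> [Qx nWx]; have [Ux|nUx] := pselect (U x); last by right.
      left; split => //; split => // Vx.
      by move: UV; apply/eqP/set0P; exists x.
    by move=> [[[Qx _] nWx]|[Qx nUx]]; split => // /WU.
  by apply: closedU => //; apply: closedI => //; exact: open_closedC.
have WQ : W = Q.
  apply: cQ; first by case: D0 => d /DW; exists d.
  - exists (~` (Q `\` W)); first exact: closed_openC.
    apply/seteqP; split => x.
      by move=> Wx; split; [case: (WK _ Wx)|case].
    by move=> [Qx nQWx]; apply: contrapT => nWx; apply: nQWx.
  - by exists W => //; rewrite setIidr// => x /WK[].
by have [_] : K q; [apply: WK; rewrite WQ|apply; apply: OV; right].
Qed.

End compact_hausdorff.

(** * Limits of chains and connected families of subcontinua *)

Section hyperspace.
Context {R : realType} {X : continuumType R}.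
Implicit Types (A B D E Q : subcontinuum X) (K : set (subcontinuum X)).

Lemma open_thicken (A : set X) (r : R) : open (thicken A r).
Proof.
rewrite openE => x /thickenP[a Aa ax]; apply/nbhs_ballP.
exists (r - mdist a x) => /=; first by rewrite subr_gt0.
move=> y; rewrite ballEmdist /= => xy; apply/thickenP; exists a => //.
by rewrite (le_lt_trans (metric_triangle a x y))// addrC -ltrBrDr.
Qed.

Lemma closed_mdist_lbound (A : set X) x : closed A -> ~ A x ->
  exists2 e : R, 0 < e & forall a, A a -> e <= mdist x a.
Proof.
move=> cA nAx; have /nbhs_ballP[e /= e0 eA] : nbhs x (~` A).
  by apply: open_nbhs_nbhs; split => //; exact: closed_openC.
exists e => // a Aa; rewrite leNgt; apply/negP => xa.
by apply: (eA a) => //; rewrite ballEmdist.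
Qed.

Lemma subcontinuum_near A B (r : R) x : mdist A B < r -> (A : set X) x ->
  exists2 y, (B : set X) y & mdist x y < r.
Proof.
rewrite mdist_subcontinuumE => AB Ax.
have [|s [_ AsB _] sr] := hausdorff_dist_lt _ AB.
  case: (subcontinuumP A) (subcontinuumP B) => A0 _ _ [B0 _ _].
  exact: (hausdorff_radii_neq0 continuum_compact).
have /thickenP[y By yx] := AsB _ Ax; exists y => //.
by rewrite metric_sym (lt_trans yx).
Qed.

Lemma mdist_le_thicken A B (r : R) : 0 < r -> (A : set X) `<=` B ->
  (B : set X) `<=` thicken A r -> mdist A B <= r.
Proof.
move=> r0 AB BA; rewrite mdist_subcontinuumE; apply: hausdorff_dist_le.
by split => // x /AB Bx; apply/thickenP; exists x => //; rewrite mdistxx.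
Qed.

Lemma is_subcontinuum_chain (F : set (subcontinuum X)) : F !=set0 ->
  total_on F (fun A B => (A : set X) `<=` B) ->
  is_subcontinuum (closure (\bigcup_(A in F) (A : set X))).
Proof.
move=> [D FD] tF; have [[d Dd] _ _] := subcontinuumP D.
split; first by exists d; apply: subset_closure; exists D.
- exact: closed_closure.
apply: connected_closure.
(* The members containing a fixed [D] have the same union, and they share the point [d]. *)
have -> : \bigcup_(A in F) (A : set X) =
    \bigcup_(A in [set A | F A /\ (D : set X) `<=` A]) (A : set X).
  apply/seteqP; split => x [A].
    move=> FA Ax; case: (tF A D FA FD) => [AD|DA]; last by exists A.
    by exists D; [split|exact: AD].
  by move=> [FA _] Ax; exists A.
apply: bigcup_connected; first by exists d => A [_ DA]; exact: DA.
by move=> A _; case: (subcontinuumP A).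
Qed.

(** Compactness as in Dini's theorem: the closed sets [L] minus [thicken A e] decrease along the
    chain and have empty intersection, so one of them is empty. *)
Lemma chain_limit (F : set (subcontinuum X)) (L : subcontinuum X) (e : R) :
  F !=set0 -> total_on F (fun A B => (A : set X) `<=` B) ->
  (L : set X) = closure (\bigcup_(A in F) (A : set X)) -> 0 < e ->
  exists2 A, F A & mdist A L <= e.
Proof.
move=> F0 tF LE e0.
have FL A : F A -> (A : set X) `<=` L.
  by move=> FA x Ax; rewrite LE; apply: subset_closure; exists A.
have [|||A FA AL] := @directed_closed_sub_open _ _ F
  (fun A => (L : set X) `\` thicken A e) set0 continuum_compact F0 _ _ open0 _.
- move=> A B FA FB; case: (tF A B FA FB) => AB; [exists B|exists A] => // x [Lx nx];
    by split; split => // -[y /AB ? ?]; apply: nx; exists y.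
- move=> A _; apply: closedI; last exact/open_closedC/open_thicken.
  by case: (subcontinuumP L).
- move=> x Lx; have [A0 FA0] := F0; have [+ _] := Lx _ FA0; rewrite LE => clx.
  have [y [[A FA Ay] xy]] := clx _ (nbhsx_ballx x _ e0).
  by have [_] := Lx _ FA; apply; exists y => //; exact: ball_sym.
exists A => //; apply: mdist_le_thicken => //; first exact: FL.
by move=> x Lx; apply: contrapT => nx; apply: (AL x).
Qed.

(* A maximal element of a nonempty clopen part exists by Zorn's lemma, and
   by boundary bumping it can only be Q. *)
Lemma upset_clopen_top Q K (C C' : set (subcontinuum X)) :
  (forall A, K A -> (A : set X) `<=` Q) ->
  (forall A B, K A -> (A : set X) `<=` B -> (B : set X) `<=` Q -> K B) ->
  open C -> closed C' -> K `&` C = K `&` C' -> K `&` C !=set0 -> (K `&` C) Q.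
Proof.
move=> KQ Kup oC cC' CC' [A0 KCA0].
pose S := {A | (K `&` C) A}.
pose le (A B : S) := `[< (proj1_sig A : set X) `<=` proj1_sig B >].
have [[D KCD] Dmax] : exists t : S, forall s, le t s -> s = t.
  apply: (@Zorn S).
  - by move=> t; exact/asboolP.
  - move=> r s t /asboolP rs /asboolP st; apply/asboolP.
    exact: subset_trans st.
  - move=> [s Ps] [t Pt] /asboolP /= st /asboolP /= ts; apply: eq_exist => /=.
    by apply: subcontinuum_inj; apply/seteqP.
  - move=> F tF; have [F0|/set0P[t0 Ft0]] := eqVneq F set0.
      by exists (exist _ A0 KCA0) => s; rewrite F0.
    pose G := [set proj1_sig s | s in F].
    have G0 : G !=set0 by exists (proj1_sig t0), t0.
    have tG : total_on G (fun A B => (A : set X) `<=` B).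
      by move=> _ _ [s Fs <-] [t Ft <-]; case: (tF s t Fs Ft) => /asboolP; [left|right].
    pose L := Subcontinuum (is_subcontinuum_chain G0 tG).
    have GL A : G A -> (A : set X) `<=` L.
      by move=> GA x Ax; apply: subset_closure; exists A.
    have KG A : G A -> (K `&` C) A by move=> [[s Ps] _ <-].
    have LQ : (L : set X) `<=` Q.
      have [_ clQ _] := subcontinuumP Q.
      rewrite /L /=; rewrite closureE; apply: smallest_sub => // x [A GA Ax].
      by have [/KQ + _] := KG _ GA; exact.
    have KL : K L.
      have [A GA] := G0; apply: (Kup A) => //; last exact: GL.
      by have [] := KG _ GA.
    (* [L] is a limit of members of the closed set [C']; equality of the traces on [K] then puts it
       back in [C]. *)
    have CL : C' L.
      apply: cC' => N /nbhs_ballP[e /= e0 eN].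
      have [|A GA AL] := @chain_limit G L (e / 2) G0 tG erefl; first by rewrite divr_gt0.
      exists A; split; first by have := KG _ GA; rewrite CC' => -[].
      apply: eN; rewrite ballEmdist /= metric_sym (le_lt_trans AL)//.
      by rewrite ltr_pdivrMr// ltr_pMr// ltr1n.
    have KCL : (K `&` C) L by rewrite CC'.
    by exists (exist _ L KCL) => s Fs; apply/asboolP; apply: GL; exists s.
have [DQ|nDQ] := pselect ((D : set X) = Q).
  by rewrite -(subcontinuum_inj DQ).
have [KD CD] := KCD.
have /nbhs_ballP[e /= e0 eC] : nbhs D C by exact: open_nbhs_nbhs.
(* Half the radius, since [mdist_le_thicken] gives a non-strict bound and [eC] needs a strict
   one. *)
have e20 : 0 < e / 2 by rewrite divr_gt0.
have [|E [sE DE EQ ED nED]] := boundary_bumping (@metric_hausdorff _ X)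
  continuum_compact (subcontinuumP D) (subcontinuumP Q) (KQ _ KD) nDQ
  (@open_thicken D (e / 2)).
  by move=> x Dx; apply/thickenP; exists x => //; rewrite mdistxx.
pose E' := Subcontinuum sE.
have KCE : (K `&` C) E'.
  split; first exact: (Kup D).
  apply: eC; rewrite ballEmdist /= (le_lt_trans (@mdist_le_thicken D E' _ e20 DE ED))//.
  by rewrite ltr_pdivrMr// ltr_pMr// ltr1n.
exfalso; apply: nED.
have eED : exist _ E' KCE = exist _ D KCD :> S by apply: Dmax; exact/asboolP.
exact: (congr1 (fun s : S => proj1_sig s : set X) eED).
Qed.

(** Every nonempty relatively clopen part of [K] contains [Q]; its complement in [K], if nonempty,
    would contain [Q] as well. *)
Lemma connected_upset Q K :
  (forall A, K A -> (A : set X) `<=` Q) ->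
  (forall A B, K A -> (A : set X) `<=` B -> (B : set X) `<=` Q -> K B) ->
  connected K.
Proof.
move=> KQ Kup B B0 [C oC BC] [C' cC' BC'].
have KCQ : (K `&` C) Q.
  by apply: (@upset_clopen_top Q K C C') => //; rewrite -?BC -?BC'.
rewrite BC; apply/seteqP; split => [A []//|A KA]; split => //.
apply: contrapT => nCA.
have [||||] := @upset_clopen_top Q K (~` C') (~` C) KQ Kup.
- exact: closed_openC.
- exact: open_closedC.
- apply/seteqP; split => D [KD nD]; split => // CD; apply: nD.
  + by have : (K `&` C) D by []; rewrite -BC BC' => -[].
  + by have : (K `&` C') D by []; rewrite -BC' BC => -[].
- exists A; split => // C'A; apply: nCA.
  by have : (K `&` C') A by []; rewrite -BC' BC => -[].
- by move=> _; apply; move: KCQ; rewrite -BC BC' => -[].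
Qed.

Lemma subcontinuum1_mdist (x y : X) :
  mdist (subcontinuum1 x) (subcontinuum1 y) <= mdist x y.
Proof.
apply/ler_addgt0Pl => e e0; rewrite mdist_subcontinuumE; apply: hausdorff_dist_le.
split; first by rewrite ltr_pwDl// mdist_ge0.
- by move=> _ ->; apply/thickenP; exists y; rewrite // metric_sym ltrDr.
- by move=> _ ->; apply/thickenP; exists x; rewrite // ltrDr.
Qed.

Lemma connected_singletons : connected (range (@subcontinuum1 R X)).
Proof.
apply: connected_continuous_connected; first exact: continuum_connected.
apply: continuous_subspaceT => x N /nbhs_ballP[e /= e0 eN].
apply/nbhs_ballP; exists e => //= y; rewrite ballEmdist /= => xy.
by apply: eN; rewrite ballEmdist /= (le_lt_trans (subcontinuum1_mdist x y)).
Qed.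

(* Every A in K is joined to a singleton {x} within K by the members of K
   lying between {x} and A. *)
Lemma connected_downset_singletons K :
  (forall x, K (subcontinuum1 x)) ->
  (forall A B, K A -> (B : set X) `<=` A -> K B) ->
  connected K.
Proof.
move=> K1 Kdown; have [x0 _] := @continuum_nondegenerate R X.
pose J A x := [set B : subcontinuum X | (B : set X) x /\ (B : set X) `<=` A].
pose P := [set Ax : subcontinuum X * X | K Ax.1 /\ (Ax.1 : set X) Ax.2].
have -> : K = \bigcup_(Ax in P) (range (@subcontinuum1 R X) `|` J Ax.1 Ax.2).
  apply/seteqP; split => [A KA|A [[B x] /= [KB Bx]]].
    have [[x Ax] _ _] := subcontinuumP A; exists (A, x) => //; right; split => //.
  by move=> [[y _ <-]//|[_ AB]]; exact: (Kdown B).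
(* All pieces share the singleton of [x0]; the two halves of a piece meet at the singleton of
   [x]. *)
apply: bigcup_connected.
  by exists (subcontinuum1 x0) => Ax _; left; exists x0.
move=> [A x] /= [KA Ax]; apply: connectedU.
- exists (subcontinuum1 x); split; first by exists x.
  by split => // _ ->.
- exact: connected_singletons.
- apply: (@connected_upset A) => [B []//|B C [Bx _] BC CA].
  by split => //; exact: BC.
Qed.

End hyperspace.

(** * Saturated sets and neighbourhoods in the quotient *)

Section HS.
Context {R : realType} {X : continuumType R} (p : X).
Implicit Types (A B D : subcontinuum X) (K : set (subcontinuum X)).

Local Notation pi := (\pi_(shrink (C_at p)) : subcontinuum X -> HS p).

(** The hypothesis describes the saturated sets, since [pi] identifies only members of [C_at p]. *)
Lemma preimage_pi_image K : C_at p `<=` K \/ K `<=` ~` C_at p ->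
  pi @^-1` (pi @` K) = K.
Proof.
move=> KC; apply/seteqP; split => [A [B KB /shrink_piP[<-//|[pB pA]]]|A KA].
  by case: KC => KC; [exact: KC|have := KC _ KB].
by exists A.
Qed.

Lemma open_pi_image K : C_at p `<=` K \/ K `<=` ~` C_at p -> open K ->
  open (pi @` K).
Proof. by move=> KC oK; apply/shrink_openP; rewrite preimage_pi_image. Qed.

Lemma HS_repr (a : HS p) : a <> HS_point p ->
  exists2 A : subcontinuum X, ~ (A : set X) p & pi A = a.
Proof.
move=> ap; exists (repr a); last exact: reprK.
by move=> /HS_pointP; rewrite reprK.
Qed.

Lemma open_ball_hyperspace A (e : R) : open (ball A e).
Proof.
rewrite openE => B; rewrite /interior ballEmdist /= => AB; apply/nbhs_ballP.
exists (e - mdist A B) => /=; first by rewrite subr_gt0.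
move=> D; rewrite !ballEmdist /= => BD.
by rewrite (le_lt_trans (metric_triangle A B D))// addrC -ltrBrDr.
Qed.

(** If [B] stays at distance at least [e] from [p], the continua meeting the [e / 2]-ball around [p]
    and those within [e / 2] of [B] form disjoint saturated open sets. *)
Lemma HS_separated B : ~ (B : set X) p ->
  exists U W : set (HS p),
    [/\ open U, open W, U (HS_point p), W (pi B) & U `&` W = set0].
Proof.
move=> nBp; have [_ clB _] := subcontinuumP B.
have [e e0 eB] := closed_mdist_lbound clB nBp.
have e20 : 0 < e / 2 by rewrite divr_gt0.
pose U0 := [set D : subcontinuum X | exists2 x, (D : set X) x & mdist p x < e / 2].
pose W0 := ball B (e / 2).
have UW0 D : U0 D -> W0 D -> False.
  move=> [x Dx px]; rewrite /W0 ballEmdist /= metric_sym => /subcontinuum_near.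
  move=> /(_ _ Dx)[y By xy]; have := eB _ By; rewrite leNgt => /negP; apply.
  by rewrite (le_lt_trans (metric_triangle p x y))// [ltRHS]splitr ltrD.
have CU0 : C_at p `<=` U0 by move=> D pD; exists p => //; rewrite mdistxx.
have W0C : W0 `<=` ~` C_at p by move=> D /[swap] /CU0 /UW0.
exists (pi @` U0), (pi @` W0); split.
- apply: open_pi_image; first by left.
  rewrite openE => D [x Dx px]; apply/nbhs_ballP.
  exists (e / 2 - mdist p x) => /=; first by rewrite subr_gt0.
  move=> D'; rewrite ballEmdist /= => /subcontinuum_near /(_ Dx)[y D'y xy].
  exists y => //; rewrite (le_lt_trans (metric_triangle p x y))//.
  by rewrite addrC -ltrBrDr.
- by apply: open_pi_image; [right|exact: open_ball_hyperspace].
- by exists (subcontinuum1 p) => //; exact: CU0.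
- by exists B => //; rewrite /W0 ballEmdist /= mdistxx.
- apply/seteqP; split => // _ [[D UD <-] WD].
  apply: (UW0 D) => //; have : (pi @^-1` (pi @` W0)) D by [].
  by rewrite preimage_pi_image//; right.
Qed.

(** Continua missing [p] have open neighbourhoods disjoint from [C_at p], hence saturated. So the
    two balls, shrunk, give open sets in the quotient: one inside the image of [K], one disjoint
    from it and thus from its closure. *)
Lemma aposyndetic_wrt_connected A B K (r s : R) : connected K ->
  ~ (A : set X) p -> ~ (B : set X) p ->
  0 < r -> ball A r `<=` K -> 0 < s -> K `&` ball B s = set0 ->
  aposyndetic_wrt (pi A) (pi B).
Proof.
move=> cK nAp nBp r0 AK s0 KB.
have avoid D : ~ (D : set X) p -> exists2 e : R, 0 < e & ball D e `<=` ~` C_at p.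
  move=> nDp; have [_ clD _] := subcontinuumP D.
  have [e e0 eD] := closed_mdist_lbound clD nDp; exists e => // D'.
  rewrite ballEmdist /= metric_sym => DD' pD'.
  have [y Dy py] := subcontinuum_near DD' pD'.
  by have := eD _ Dy; rewrite leNgt py.
have openpi D (O : set (subcontinuum X)) : ~ (D : set X) p -> open O ->
    O D -> exists N : set (HS p), [/\ open N, N (pi D) & pi @^-1` N `<=` O].
  move=> nDp oO OD; have [e e0 eC] := avoid D nDp.
  have C : ball D e `&` O `<=` ~` C_at p by move=> D' [/eC].
  exists (pi @` (ball D e `&` O)); split.
  - apply: open_pi_image; first by right.
    by apply: openI => //; exact: open_ball_hyperspace.
  - by exists D => //; split => //; rewrite ballEmdist /= mdistxx.
  - by rewrite preimage_pi_image; [move=> D' []|right].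
have pisurj (y : HS p) : exists D, pi D = y by exists (repr y); exact: reprK.
exists (closure (pi @` K)); split.
- split; last 1 first.
  + apply: connected_closure; apply: connected_continuous_connected => //.
    by apply: continuous_subspaceT; exact: pi_continuous.
  + exists (pi A); apply: subset_closure; exists A => //.
    by apply: AK; rewrite ballEmdist /= mdistxx.
  + exact: closed_closure.
- have [||N [oN NA NK]] := openpi A (ball A r) nAp.
  + exact: open_ball_hyperspace.
  + by rewrite ballEmdist /= mdistxx.
  apply: (@filterS _ _ _ N); last exact: open_nbhs_nbhs.
  move=> y Ny.
  have [D Dy] := pisurj y; apply: subset_closure; exists D => //.
  by apply: AK; apply: NK; rewrite /= Dy.
- move=> clB; have [||N [oN NB NK]] := openpi B (ball B s) nBp.
  + exact: open_ball_hyperspace.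
  + by rewrite ballEmdist /= mdistxx.
  have [_ [[D KD <-] ND]] := clB N (open_nbhs_nbhs (conj oN NB)).
  have : (K `&` ball B s) D by split => //; exact: NK.
  by rewrite KB.
Qed.

End HS.

Theorem theorem8p1 (R : realType) (X : continuumType R) (p : X) :
  locally_connected_at (HS_point p) ->
  aposyndetic_at (HS_point p) /\
  forall a b : HS p, a <> HS_point p -> b <> HS_point p -> a <> b ->
    aposyndetic_wrt a b.
Proof.
move=> lc; split.
  move=> _ /HS_repr[B nBp <-].
  have [U [W [oU oW Up WB UW]]] := HS_separated nBp.
  have [V [oV Vp cV VU]] := lc U oU Up.
  exists (closure V); split.
  - split; [by exists (HS_point p); exact: subset_closure|exact: closed_closure|].
    exact: connected_closure.
  - apply: (@filterS _ _ _ V); first exact: subset_closure.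
    exact: open_nbhs_nbhs.
  - move=> clB; have [x [/VU Ux Wx]] := clB W (open_nbhs_nbhs (conj oW WB)).
    by have : (U `&` W) x by []; rewrite UW.
move=> _ _ /HS_repr[A nAp <-] /HS_repr[B nBp <-] nAB.
have [_ clA _] := subcontinuumP A; have [_ clB _] := subcontinuumP B.
have [AB|/existsNP[x /not_implyP[Ax nBx]]] := pselect ((A : set X) `<=` B); last first.
  have [e e0 eB] := closed_mdist_lbound clB nBx.
  have e20 : 0 < e / 2 by rewrite divr_gt0.
  have cX : is_subcontinuum [set: X].
    by split; [exists x|exact: closedT|exact: continuum_connected].
  (* Each such [D] has a point within [e / 2] of [x], while [B] is at distance at least [e] from
     [x]; so [D] is not within [e / 2] of [B]. *)
  pose K := [set D : subcontinuum X | exists2 A' : subcontinuum X,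
    mdist A A' < e / 2 & (A' : set X) `<=` D].
  apply: (@aposyndetic_wrt_connected _ _ _ _ _ K (e / 2) (e / 2)) => //.
  - apply: (@connected_upset _ _ (Subcontinuum cX)) => // D D' [A' AA' A'D] DD' _.
    by exists A' => //; exact: subset_trans DD'.
  - by move=> D; rewrite ballEmdist /= => AD; exists D.
  - apply/seteqP; split => // D [[A' AA' A'D]]; rewrite ballEmdist /= metric_sym => DB.
    have [y /A'D Dy xy] := subcontinuum_near AA' Ax.
    have [z Bz yz] := subcontinuum_near DB Dy.
    have := eB _ Bz; rewrite leNgt => /negP; apply.
    by rewrite (le_lt_trans (metric_triangle x y z))// [ltRHS]splitr ltrD.
have [y By nAy] : exists2 y, (B : set X) y & ~ (A : set X) y.
  apply: contrapT => nBA; apply: nAB; congr (\pi _); apply: subcontinuum_inj.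
  apply/seteqP; split => // y By; apply: contrapT => nAy; apply: nBA; by exists y.
have [[x Ax] _ _] := subcontinuumP A.
have [e e0 eA] := closed_mdist_lbound clA nAy.
have e20 : 0 < e / 2 by rewrite divr_gt0.
(* Degeneracy is stated as inclusion in a singleton, so that both clauses pass to subcontinua. *)
pose K := [set D : subcontinuum X | (exists z, (D : set X) `<=` [set z]) \/
  exists2 A' : subcontinuum X, mdist A A' < e / 2 & (D : set X) `<=` A'].
apply: (@aposyndetic_wrt_connected _ _ _ _ _ K (e / 2) (e / 2)) => //.
- apply: connected_downset_singletons => [z|D D' KD D'D].
    by left; exists z.
  case: KD => [[z Dz]|[A' AA' DA']]; [left; exists z|right; exists A' => //];
    exact: subset_trans D'D _.
- by move=> D; rewrite ballEmdist /= => AD; right; exists D.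
- apply/seteqP; split => // D [+]; rewrite ballEmdist /= => + BD.
  have [u Du yu] := subcontinuum_near BD By.
  (* The point [u] of [D] is within [e / 2] of [y]. If [D] is degenerate, [x], which is in [B] too,
     is also within [e / 2] of [u]; otherwise [u] is in [A'], within [e / 2] of a point of [A].
     Either way [y] is too close to [A]. *)
  case=> [[z Dz]|[A' AA' DA']].
    have [v Dv xv] := subcontinuum_near BD (AB _ Ax).
    have := eA _ Ax; rewrite leNgt => /negP; apply.
    rewrite (le_lt_trans (metric_triangle y u x))// [ltRHS]splitr ltrD//.
    by rewrite metric_sym (Dz _ Du) -(Dz _ Dv).
  have A'A : mdist A' A < e / 2 by rewrite metric_sym.
  have [v Av uv] := subcontinuum_near A'A (DA' _ Du).
  have := eA _ Av; rewrite leNgt => /negP; apply.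
  by rewrite (le_lt_trans (metric_triangle y u v))// [ltRHS]splitr ltrD.
Qed.
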